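(* Let $n\ge 2$ and let $\mathbf u$ be a transpositional sequence in $\mathrm{Sym}(n)$ whose transpositional multigraph $\mathcal T(\mathbf u)$ is a multitree on vertex set $n$ with no multiedge of even multiplicity, and none of whose vertices lies on more than one non-simple multiedge. Then every element of $\mathrm{Prod}(\mathbf u)$ is an $n$-cycle, i.e. $\mathrm{Prod}(\mathbf u)\subseteq n^1$.
   Context: $n=\{0,\ldots,n-1\}$; permutations compose left to right. For a finite sequence $\mathbf s$ in $\mathrm{Sym}(n)$, $\bigcirc\mathbf s$ is the composite of its terms in order, $\mathrm{Seq}(\mathbf s)$ the set of rearrangements and $\mathrm{Prod}(\mathbf s)=\{\bigcirc\mathbf r:\mathbf r\in\mathrm{Seq}(\mathbf s)\}$. $n^1$ denotes the set of $n$-cycles in $\mathrm{Sym}(n)$. For a sequence $\mathbf u$ of transpositions, $\mathcal T(\mathbf u)$ is the multigraph on vertex set $n$ in which the multiedge $(x\,y)$ has multiplicity equal to the number of terms of $\mathbf u$ equal to $(x\,y)$. A multiedge is non-simple if its multiplicity is at least $2$. A multitree is a multigraph whose underlying simple graph (ignoring multiplicities) is a tree. *)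

(* Defs.v *)
From HB Require Import structures.
From mathcomp Require Import all_boot all_fingroup.

Set Implicit Arguments.
Unset Strict Implicit.
Unset Printing Implicit Defensive.

Import GroupScope.

(* Loopless multigraphs on T: [mult x y] is the number of edges joining x and
   y, and the multiedges are the pairs {x, y} with [mult x y > 0]. *)
Record multigraph (T : finType) := Multigraph {
  mult :> T -> T -> nat;
  mult_sym : forall x y, mult x y = mult y x;
  mult_irr : forall x, mult x x = 0
}.

Section Multigraph.
Variables (T : finType) (g : multigraph T).

Definition multiedge : rel T := fun x y => 0 < g x y.
Definition nonsimple : rel T := fun x y => 1 < g x y.

End Multigraph.

(* The bound 2 on the size of e-cycles discards the degenerate closed walks
   x, y, x along a single edge. *)
Definition is_tree (T : finType) (e : rel T) : Prop :=
  [/\ forall x y, connect e x y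
    & forall c : seq T, uniq c -> path.cycle e c -> size c <= 2].

Definition multitree (T : finType) (g : multigraph T) : Prop :=
  is_tree (multiedge g).

Section Permutations.
Variable n : nat.
Implicit Types (t : 'S_n) (s u : seq 'S_n).

Definition is_transposition t : bool :=
  [exists x, exists y, (x != y) && (t == tperm x y)].

Definition transpositional u : bool := all is_transposition u.

(* The product in 'S_n is left-to-right composition: (s * t) x = t (s x). *)
Definition compose s : 'S_n := \prod_(t <- s) t.

Definition Prod s : {set 'S_n} :=
  [set p in [seq compose r | r <- permutations s]].

(* The permutations (c_0 c_1 ... c_(n-1)) with c_0, ..., c_(n-1) distinct. *)
Definition n_cycles : {set 'S_n} :=
  [set p : 'S_n | [exists c : n.-tuple 'I_n, uniq c && fcycle p c]].

Definition tmult u (x y : 'I_n) : nat :=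
  if x == y then 0 else count_mem (tperm x y) u.

Lemma tmult_sym u x y : tmult u x y = tmult u y x.
Proof. by rewrite /tmult eq_sym tpermC. Qed.

Lemma tmult_irr u x : tmult u x x = 0.
Proof. by rewrite /tmult eqxx. Qed.

Definition Tgraph u : multigraph 'I_n :=
  Multigraph (tmult_sym u) (tmult_irr u).

End Permutations.

(* Main.v *)
(** Deleting a simple edge [{x, y}] of a forest separates [x] from [y], while
    the product only loses a factor conjugate to [tperm x y] whose two points
    lie in different orbits, so restoring the edge merges exactly these two
    orbits.  By induction we may assume that no edge is simple.  The edges then
    form a matching, and on each of them the product acts as an odd power of
    the corresponding transposition.  Hence the orbits of the product are the
    connected components of the multigraph. *)
Require Import Defs.
From mathcomp Require Import all_boot all_fingroup.

Set Implicit Arguments.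
Unset Strict Implicit.
Unset Printing Implicit Defensive.

(** A duplicate-free [e']-path from [x] to [y], closed by the edge from [y] back to [x], is an
    [e]-cycle. The size bound leaves only [x = y] or a direct step [e' x y], both excluded. *)
Lemma cycle_bound_not_connect (T : finType) (e e' : rel T) (x y : T) :
    subrel e' e -> e y x -> ~~ e' x y -> x != y ->
    (forall c : seq T, uniq c -> path.cycle e c -> size c <= 2) ->
  ~~ connect e' x y.
Proof.
move=> sub_e eyx ne'xy neq_xy acyc; apply/negP=> /connectP[p0 e'p0].
case/shortenP: e'p0 => p e'p Up _ def_y.
have := acyc (x :: p) Up; rewrite /= rcons_path (sub_path sub_e e'p) -def_y eyx.
move/(_ isT); case: p e'p Up def_y => [|z [|//]] /=.
  by move=> _ _ def_y; rewrite def_y eqxx in neq_xy.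
by rewrite andbT => e'xz _ def_y; rewrite def_y e'xz in ne'xy.
Qed.

Section PermOrbits.
Import GroupScope.
Variable T : finType.
Implicit Types (s : {perm T}) (x y z : T).

Lemma mem_porbit_step s s' :
  (forall z, s z \in porbit s' z) ->
  forall x y, y \in porbit s x -> y \in porbit s' x.
Proof.
move=> step x y /porbitP[i ->]; elim: i => [|i IHi].
  by rewrite expg0 perm1 porbit_id.
rewrite expgSr permM; move: (step ((s ^+ i) x)).
by rewrite -!eq_porbit_mem in IHi * => /eqP->.
Qed.

(* The cycle count of [tperm x y * s] falls by one when [x] and [y] lie in
   different [s]-orbits, which excludes that they are still separated. *)
Lemma porbit_mul_tperm_mem s x y :
  x \notin porbit s y -> x \in porbit (tperm x y * s) y.
Proof.
move=> nsxy; apply/negPn/negP=> nsxy'.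
have neq_xy : x != y by apply: contraNneq nsxy => ->; exact: porbit_id.
have := porbits_mul_tperm s x y; have := porbits_mul_tperm (tperm x y * s) x y.
rewrite /= mulgA tperm2 mul1g nsxy nsxy' neq_xy /= !addn2 !addn1 => -[<-] -[].
by move/eqP; rewrite -addn2 -[X in _ == X]addn0 eqn_add2l.
Qed.

(** A step of [s] is the swap of [x] and [y] followed by a step of [tperm x y * s]. The swap stays
    within an orbit of the new product, since that product has joined [x] and [y]. *)
Lemma porbit_mul_tperm_sub s x y u v :
  x \notin porbit s y -> v \in porbit s u ->
  v \in porbit (tperm x y * s) u.
Proof.
move=> /porbit_mul_tperm_mem s'xy; move: u v; set s' := _ * s.
have s'E z : s' (tperm x y z) = s z by rewrite permM tpermK.
apply: mem_porbit_step => z; rewrite -s'E -eq_porbit_mem.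
have /eqP-> : porbit s' (s' (tperm x y z)) == porbit s' (tperm x y z).
  by rewrite eq_porbit_mem (mem_porbit s' 1).
rewrite eq_porbit_mem.
by case: tpermP => [->|->|_ _]; rewrite ?porbit_id // porbit_sym.
Qed.

Lemma fcycle_traject_porbit s x : fcycle s (traject s x #|porbit s x|).
Proof.
case def_m: #|porbit s x| => [|m] //=.
by rewrite -{3}(iter_porbit s x) def_m iterSr -trajectSr fpath_traject.
Qed.

End PermOrbits.

Section TranspositionSequences.
Import GroupScope.
Variable n : nat.
Implicit Types (u s a b : seq 'S_n) (x y z : 'I_n).

Local Notation edge u := (multiedge (Tgraph u)).

Lemma compose_cat a b : compose (a ++ b) = compose a * compose b.
Proof. by rewrite /compose big_cat. Qed.

Lemma compose_cons (t : 'S_n) s : compose (t :: s) = t * compose s.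
Proof. by rewrite /compose big_cons. Qed.

Lemma edge_sym u : symmetric (edge u).
Proof. by move=> x y; rewrite /multiedge mult_sym. Qed.

Lemma is_transpositionP (t : 'S_n) :
  is_transposition t -> exists x y, x != y /\ t = tperm x y.
Proof. by case/existsP=> x /existsP[y /andP[neq_xy /eqP->]]; exists x, y. Qed.

Lemma edgeE u x y : edge u x y = (x != y) && (tperm x y \in u).
Proof.
rewrite /multiedge /= /tmult; case: eqP => //= _.
by rewrite -has_count has_pred1.
Qed.

(** Each factor fixes a point or moves it along one edge. Keeping [s] apart from [u] fixes the graph
    during the induction and covers prefixes of [u]. *)
Lemma connect_compose u s z :
  transpositional u -> {subset s <= u} -> connect (edge u) z (compose s z).
Proof.
move=> /allP tr_u; elim: s z => [|t s IHs] z sub_su.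
  by rewrite /compose big_nil perm1 connect0.
have tu : t \in u by apply: sub_su; rewrite mem_head.
rewrite compose_cons permM; apply: connect_trans (IHs _ _); last first.
  by move=> w ws; apply: sub_su; rewrite inE ws orbT.
have [x [y [neq_xy def_t]]] := is_transpositionP (tr_u t tu).
have exy : edge u x y by rewrite edgeE neq_xy -def_t.
rewrite def_t; case: tpermP => [->|->|_ _]; last exact: connect0.
  exact: connect1.
by rewrite connect1 // edge_sym.
Qed.

Lemma connect_porbit u x y :
  transpositional u -> y \in porbit (compose u) x -> connect (edge u) x y.
Proof.
move=> tr_u /porbitP[i ->]; elim: i => [|i IHi].
  by rewrite expg0 perm1 connect0.
by rewrite expgSr permM (connect_trans IHi) // connect_compose.
Qed.

(** The image of [x] never leaves the pair [x], [y], and toggles at each occurrence of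
    [tperm x y]. *)
Lemma compose_isolated_edge s x y :
    {in s, forall t : 'S_n, t = tperm x y \/ t x = x /\ t y = y} ->
  compose s x = if odd (count_mem (tperm x y) s) then y else x.
Proof.
elim/last_ind: s => [|s t IHs] st; first by rewrite /compose big_nil perm1.
rewrite -cats1 compose_cat permM IHs; last first.
  by move=> w ws; apply: st; rewrite mem_rcons inE ws orbT.
rewrite compose_cons /compose big_nil mulg1 count_cat /= addn0 oddD.
have ts : t \in rcons s t by rewrite mem_rcons mem_head.
have [->|[tx ty]] := st t ts.
  by rewrite eqxx addbT if_neg; case: odd; rewrite ?tpermL ?tpermR.
case: eqP => [def_t | _]; last by rewrite addbF; case: odd.
have eq_xy : y = x by rewrite -tx def_t tpermL.
by rewrite eq_xy !if_same tx.
Qed.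

(** Converse of [connect_porbit]. It is stated for forests, because deleting an edge of a tree
    disconnects it. *)
Lemma connect_mem_porbit u :
    transpositional u ->
    (forall c : seq 'I_n, uniq c -> path.cycle (edge u) c -> size c <= 2) ->
    (forall x y, edge u x y -> odd (Tgraph u x y)) ->
    (forall x y z, nonsimple (Tgraph u) x y -> nonsimple (Tgraph u) x z ->
       y = z) ->
  forall x y, connect (edge u) x y -> y \in porbit (compose u) x.
Proof.
have [N] := ubnP (size u); elim: N u => // N IHN u leuN tr_u acyc odd_u match_u.
suff edge_porbit : forall x y, edge u x y -> y \in porbit (compose u) x.
  move=> x y /connectP[p]; elim: p x => [|z p IHp] x /=.
    by move=> _ ->; exact: porbit_id.
  case/andP=> /edge_porbit xz /IHp zy /zy.
  by rewrite -eq_porbit_mem in xz; rewrite (eqP xz).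
have [/hasP[t tu /eqP t1] | /hasPn no_simple] :=
  boolP (has (fun t => count_mem t u == 1%N) u).
  have [v [w [neq_vw def_t]]] := is_transpositionP (allP tr_u t tu).
  have evw : edge u w v by rewrite edgeE eq_sym neq_vw tpermC -def_t.
  case/splitPr: u / tu => a b in leuN tr_u acyc odd_u match_u t1 evw *.
  pose u' := a ++ b; set u := a ++ _ in leuN tr_u acyc odd_u match_u t1 evw *.
  have sub_u : {subset u' <= u}.
    by move=> z; rewrite !mem_cat inE => /orP[->|->]; rewrite ?orbT.
  have count_u (w0 : 'S_n) : count_mem w0 u = (t == w0) + count_mem w0 u'.
    by rewrite !count_cat /= addnCA.
  have tr_u' : transpositional u' by apply/allP=> z /sub_u; apply/allP.
  have mult_u' x y : t != tperm x y -> Tgraph u' x y = Tgraph u x y.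
    by move=> neq_t; rewrite /= /tmult count_u (negPf neq_t).
  (* The only copy of [t] is gone, so every surviving edge keeps its multiplicity and the hypotheses
     pass to [u']. *)
  have nt : t \notin u'.
    rewrite -has_pred1 has_count; move: t1.
    by rewrite count_u eqxx add1n => -[->].
  have sub_e : subrel (edge u') (edge u).
    by move=> x y; rewrite !edgeE => /andP[-> /sub_u].
  have edge_mult x y : edge u' x y -> Tgraph u' x y = Tgraph u x y.
    rewrite edgeE => /andP[_ xyu']; apply: mult_u'.
    by apply: contraNneq nt => ->.
  have ns_edge x y : nonsimple (Tgraph u') x y -> nonsimple (Tgraph u) x y.
    by move=> xy; rewrite /nonsimple -edge_mult // /multiedge ltnW.
  have IHu' : forall x y, connect (edge u') x y -> y \in porbit (compose u') x.
    apply: IHN => //.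
    - by move: leuN; rewrite !size_cat /= addnS.
    - move=> c Uc cyc; apply: acyc => //.
      by case: c cyc {Uc} => //= z c; apply: sub_path.
    - by move=> x y xy; rewrite edge_mult // odd_u // sub_e.
    - by move=> x y z /ns_edge xy /ns_edge; apply: match_u.
  have ncvw : ~~ connect (edge u') v w.
    apply: cycle_bound_not_connect acyc => //.
    by rewrite edgeE neq_vw -def_t.
  have csym := sym_connect_sym (edge_sym u').
  (* Moving [t] to the front past [a] conjugates it by the inverse of [g], which turns its points
     into [v'] and [w']. *)
  pose g := compose a; pose v' := g^-1 v; pose w' := g^-1 w.
  have to_g z : connect (edge u') (g^-1 z) z.
    rewrite -{2}[z](permKV g); apply: connect_compose => // x xa.
    by rewrite mem_cat xa.
  have def_u : compose u = tperm v' w' * compose u'.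
    rewrite !compose_cat compose_cons def_t /v' /w' -tpermJ -/g.
    by rewrite conjgE invgK !mulgA mulgKV.
  (* In the graph of [u'], [v'] is connected to [v] and [w'] to [w], so a common orbit would
     reconnect [v] and [w]. *)
  have nv'w' : v' \notin porbit (compose u') w'.
    apply: contra ncvw => /(connect_porbit tr_u') cwv.
    rewrite csym; apply: connect_trans (to_g v); apply: connect_trans cwv.
    by rewrite csym; exact: to_g.
  have sub_orb x y : connect (edge u') x y -> y \in porbit (compose u) x.
    by move=> /IHu' xy; rewrite def_u porbit_mul_tperm_sub.
  have vw : w \in porbit (compose u) v.
    have wv' := porbit_mul_tperm_mem nv'w'; rewrite -def_u in wv'.
    have := sub_orb _ _ (to_g v); have := sub_orb _ _ (to_g w).
    rewrite -!eq_porbit_mem in wv' *.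
    by move=> /eqP-> /eqP->; rewrite eq_sym.
  (* Every edge other than the deleted one survives in [u']. For the deleted one, [t x = y]
     determines which endpoint is [v]. *)
  move=> x y; have [eq_t | neq_t] := eqVneq t (tperm x y); last first.
    rewrite /multiedge -mult_u' // => xy; apply: sub_orb; exact: connect1.
  rewrite edgeE => /andP[neq_xy _].
  have txy : t x = y by rewrite eq_t tpermL.
  move: txy neq_xy; rewrite def_t.
  case: tpermP => [->|->|_ _] <- => [//|_|/eqP//].
  by rewrite porbit_sym.
have edge_ns x y : edge u x y -> nonsimple (Tgraph u) x y.
  move=> xy; move: (xy); rewrite edgeE => /andP[neq_xy /no_simple].
  move: xy; rewrite /nonsimple /multiedge /= /tmult (negPf neq_xy).
  by case: count => [|[]].
move=> x y exy; have := odd_u x y exy; have := exy.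
rewrite edgeE /= /tmult => /andP[neq_xy _]; rewrite (negPf neq_xy) => odd_xy.
suff <- : compose u x = y by exact: (mem_porbit _ 1).
rewrite (@compose_isolated_edge _ _ y) ?odd_xy // => t tu.
have [v [w [neq_vw def_t]]] := is_transpositionP (allP tr_u t tu).
have evw : edge u v w by rewrite edgeE neq_vw -def_t.
have ewv : edge u w v by rewrite edge_sym.
have eyx : edge u y x by rewrite edge_sym.
have uniq_nbr x1 y1 z1 : edge u x1 y1 -> edge u x1 z1 -> y1 = z1.
  by move=> /edge_ns ns1 /edge_ns; apply: match_u.
(* Since the edges form a matching, a factor touching [x] or [y] must be [tperm x y] itself. *)
case: (eqVneq v x) => [eq_vx | nvx].
  by left; rewrite def_t eq_vx in evw *; rewrite (uniq_nbr _ _ _ evw exy).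
case: (eqVneq w x) => [eq_wx | nwx].
  left; rewrite def_t eq_wx tpermC in ewv *.
  by rewrite (uniq_nbr _ _ _ ewv exy).
case: (eqVneq v y) => [eq_vy | nvy].
  by rewrite eq_vy in evw; rewrite (uniq_nbr _ _ _ evw eyx) eqxx in nwx.
case: (eqVneq w y) => [eq_wy | nwy].
  by rewrite eq_wy in ewv; rewrite (uniq_nbr _ _ _ ewv eyx) eqxx in nvx.
by right; rewrite def_t !tpermD.
Qed.

Lemma mem_n_cycles (p : 'S_n) x :
  (forall y, y \in porbit p x) -> p \in n_cycles n.
Proof.
move=> orb_x; have card_x : #|porbit p x| = n.
  by rewrite -[RHS]card_ord; apply: eq_card => y; rewrite orb_x.
have sz : size (traject p x #|porbit p x|) == n by rewrite size_traject card_x.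
rewrite inE; apply/existsP; exists (Tuple sz).
by rewrite uniq_traject_porbit fcycle_traject_porbit.
Qed.

End TranspositionSequences.

Theorem theorem3p4 (n : nat) (u : seq 'S_n) :
  1 < n ->
  transpositional u ->
  multitree (Tgraph u) ->
  (forall x y : 'I_n, multiedge (Tgraph u) x y -> odd (Tgraph u x y)) ->
  (forall x y z : 'I_n,
     nonsimple (Tgraph u) x y -> nonsimple (Tgraph u) x z -> y = z) ->
  Prod u \subset n_cycles n.
Proof.
move=> n_gt1 tr_u [conn acyc] odd_u match_u; apply/subsetP=> p.
rewrite inE => /mapP[r]; rewrite mem_permutations => perm_ru ->.
(* Rearranging preserves multiplicities, so all hypotheses transfer from [u] to [r]. *)
have multE x y : Tgraph r x y = Tgraph u x y.
  by rewrite /= /tmult (seq.permP perm_ru).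
have edgeE : multiedge (Tgraph r) =2 multiedge (Tgraph u).
  by move=> x y; rewrite /multiedge multE.
have x : 'I_n := Ordinal (ltnW n_gt1).
apply: (@mem_n_cycles _ _ x) => y; apply: connect_mem_porbit.
- by rewrite /transpositional (perm_all _ perm_ru).
- by move=> c Uc; rewrite (eq_cycle edgeE); apply: acyc.
- by move=> a b; rewrite edgeE multE; apply: odd_u.
- by move=> a b c; rewrite /nonsimple !multE; apply: match_u.
by rewrite (eq_connect edgeE).
Qed.
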